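(* Let $\mathcal{H}$ be a complex Hilbert space, let $A\in\mathcal{B}(\mathcal{H})$ be positive semidefinite, and let $T\in\mathcal{B}_A(\mathcal{H})$. Then $$\frac12\left\{w_A^2(T+|T|_A^2)+c_A^2(T-|T|_A^2)\right\}\ \le\ dw_A^2(T)\ \le\ \frac12\left\{w_A^2(T+|T|_A^2)+w_A^2(T-|T|_A^2)\right\}.$$
   Context: $\mathcal{B}(\mathcal{H})$ is the algebra of bounded linear operators on the complex Hilbert space $\mathcal{H}$. For a positive semidefinite $A\in\mathcal{B}(\mathcal{H})$, put $\langle x,y\rangle_A=\langle Ax,y\rangle$ and $\|x\|_A=\sqrt{\langle x,x\rangle_A}$. $\mathcal{B}_A(\mathcal{H})$ is the set of $T\in\mathcal{B}(\mathcal{H})$ admitting an $A$-adjoint, i.e. such that $AX=T^*A$ has a solution $X\in\mathcal{B}(\mathcal{H})$; then $T^{\sharp_A}$ denotes the unique solution with $\mathcal{R}(T^{\sharp_A})\subseteq\overline{\mathcal{R}(A)}$ ($\mathcal{R}$ denotes range). Every $T\in\mathcal{B}_A(\mathcal{H})$ is $A$-bounded, i.e. $\|Tx\|_A\le c\|x\|_A$ for all $x$ and some $c>0$. Write $|T|_A^2=T^{\sharp_A}T$. For $A$-bounded $T$: $w_A(T)=\sup\{|\langle Tx,x\rangle_A|:\|x\|_A=1\}$, $c_A(T)=\inf\{|\langle Tx,x\rangle_A|:\|x\|_A=1\}$, and $dw_A(T)=\sup\{\sqrt{|\langle Tx,x\rangle_A|^2+\|Tx\|_A^4}:\|x\|_A=1\}$,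 where $x$ ranges over $\mathcal{H}$. Notation such as $dw_A^2(T)$ means $(dw_A(T))^2$. *)

(* Defs.v *)
From mathcomp Require Import all_boot all_order all_algebra.
From mathcomp Require Import all_classical all_reals all_analysis.
From mathcomp Require Export complex.

Set Implicit Arguments.
Unset Strict Implicit.
Unset Printing Implicit Defensive.

Import Order.TTheory GRing.Theory Num.Theory.
Import numFieldNormedType.Exports.

Local Open Scope classical_set_scope.
Local Open Scope complex_scope.
Local Open Scope ring_scope.

(* A complex Hilbert space is a complete normed space over R[i] whose norm is
   induced by an inner product, linear in its first argument. *)
Definition norm_induced_by (R : realType) (H : completeNormedModType R[i])
    (ip : {dot H for @Num.conj R[i]}) : Prop :=
  forall x : H, `|x| ^+ 2 = ip x x.

Section Operators.
Context {R : realType} {H : completeNormedModType R[i]}.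
Variable ip : {dot H for @Num.conj R[i]}.

Definition bounded_operators : set (H -> H) :=
  [set T | linear T /\ exists M : R, forall x, `|T x| <= M%:C * `|x|].

(* The order of R[i] makes [0 <= z] mean that z is real and nonnegative. *)
Definition positive_semidefinite (A : H -> H) : Prop :=
  forall x, 0 <= ip (A x) x.

(* [adjoint] and [sharp] pick the operator with the defining property; it exists
   and is unique for bounded (resp. A-adjointable) T.  The 0 is a junk default. *)
Definition adjoint (T : H -> H) : H -> H :=
  xget (fun=> 0) [set S | bounded_operators S /\
                          forall x y, ip (T x) y = ip x (S y)].

Section SemiInner.
Variable A : H -> H.

Definition A_ip (x y : H) : R[i] := ip (A x) y.

Definition A_norm (x : H) : R := Num.sqrt (complex.Re (A_ip x x)).

Definition A_adjoints (T : H -> H) : set (H -> H) :=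
  [set X | bounded_operators X /\ A \o X = adjoint T \o A].

Definition A_adjointable : set (H -> H) :=
  [set T | bounded_operators T /\ A_adjoints T !=set0].

Definition sharp (T : H -> H) : H -> H :=
  xget (fun=> 0) [set X | A_adjoints T X /\ range X `<=` closure (range A)].

Definition A_abs2 (T : H -> H) : H -> H := sharp T \o T.

Definition A_sphere : set H := [set x | A_norm x = 1].

(* [sup] and [inf] are those of R.  The sets below are bounded for A-bounded T;
   when A = 0 they are empty and the library gives [sup set0 = inf set0 = 0]. *)
Definition w_A (T : H -> H) : R :=
  sup [set Normc.normc (A_ip (T x) x) | x in A_sphere].

Definition c_A (T : H -> H) : R :=
  inf [set Normc.normc (A_ip (T x) x) | x in A_sphere].

Definition dw_A (T : H -> H) : R :=
  sup [set Num.sqrt (Normc.normc (A_ip (T x) x) ^+ 2 + A_norm (T x) ^+ 4)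
      | x in A_sphere].

End SemiInner.
End Operators.

(* Main.v *)
(* Write a = <Tx,x>_A and b = ||Tx||_A^2 = <|T|_A^2 x,x>_A.  The parallelogram
   identity |a+b|^2 + |a-b|^2 = 2(|a|^2 + b^2) holds at each x of the A-sphere,
   and taking suprema and infima gives both inequalities, once the suprema are
   known to be finite and T^#A to be the genuine object.
   - T^* comes from the Riesz theorem, and T^#A = P X, where X is any A-adjoint
     and P the orthogonal projection onto the closure of the range of A.
   - T is A-bounded: S = T^#A T is A-symmetric, so n |-> ||S^n x||_A^2 is
     log-convex; it is also O(M^n), since S is bounded and ||.||_A is dominated
     by the norm.  Hence ||S x||_A^2 <= M ||x||_A^2, and
     ||Tx||_A^2 = <Sx,x>_A is controlled by Cauchy-Schwarz. *)
Require Import Defs.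
From mathcomp Require Import all_boot all_order all_algebra.
From mathcomp Require Import all_classical all_reals all_analysis.
From mathcomp Require Import complex.
From mathcomp Require Import ring lra.

Set Implicit Arguments.
Unset Strict Implicit.
Unset Printing Implicit Defensive.

Import Order.TTheory GRing.Theory Num.Theory.
Import numFieldNormedType.Exports.
Local Open Scope classical_set_scope.
Local Open Scope complex_scope.
Local Open Scope ring_scope.

(** * Real inequalities, sequences and suprema *)

(** The value at the minimizer [t = - b / c] is the discriminant condition. If [c = 0] and [b] is
    nonzero, a suitable [t] gives the value [-1]. *)
Lemma quadratic_ge0 (F : realFieldType) (a b c : F) :
  0 <= c -> (forall t, 0 <= a + 2 * t * b + t ^+ 2 * c) -> b ^+ 2 <= a * c.
Proof.
rewrite le_eqVlt => /predU1P[<-|c0] h; last first.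
  rewrite -subr_ge0.
  have -> : a * c - b ^+ 2 =
      c * (a + 2 * - (b / c) * b + (- (b / c)) ^+ 2 * c).
    by field; rewrite gt_eqF.
  exact: mulr_ge0 (ltW c0) (h _).
rewrite mulr0; have [->|b0] := eqVneq b 0; first by rewrite expr0n.
have := h (- ((a + 1) / (2 * b))).
have -> : a + 2 * - ((a + 1) / (2 * b)) * b + (- ((a + 1) / (2 * b))) ^+ 2 * 0 = - 1.
  by field.
lra.
Qed.

(** The limit form of Cauchy-Schwarz: an approximation of squared size [e] bounds the square of an
    inner product by [e * K]. *)
Lemma eq0_le_sqr (F : realFieldType) (d K : F) :
  (forall e, 0 < e -> d ^+ 2 <= e * K) -> d = 0.
Proof.
move=> h; apply/eqP; rewrite -sqrf_eq0 eq_le sqr_ge0 andbT.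
have [K0|K0] := leP K 0.
  by apply: (le_trans (h 1 ltr01)); rewrite mul1r.
apply/ler_addgt0Pl => e e0; rewrite addr0.
by have := h (e / K); rewrite divr_gt0// divfK ?gt_eqF//; exact.
Qed.

(** Since [M <= (M + 1) ^+ 2], the constant [M + 1] serves in place of the square root of [M]. *)
Lemma le_succ_mul_of_sqr (F : realFieldType) (u v M : F) :
  0 <= u -> 0 <= v -> 0 <= M -> u ^+ 2 <= M * v * v -> u <= (M + 1) * v.
Proof.
move=> u0 v0 M0 h; rewrite -(@ler_pXn2r _ 2%N)// ?nnegrE ?mulr_ge0 ?addr_ge0//.
apply: (le_trans h); rewrite exprMn -mulrA -expr2.
by apply: ler_wpM2r; [exact: sqr_ge0|nra].
Qed.

(* The ratios [p n.+1 / p n] are nondecreasing. *)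
Lemma log_convex_le (R : realType) (p : nat -> R) (C M : R) : 0 < M ->
  (forall n, 0 <= p n) -> (forall n, p n.+1 ^+ 2 <= p n * p n.+2) ->
  (forall n, p n <= C * M ^+ n) -> p 1%N <= M * p 0%N.
Proof.
move=> M0 p_ge0 pconv pbd; rewrite leNgt; apply/negP => lt.
have p0 : 0 < p 0%N.
  rewrite lt_neqAle p_ge0 andbT eq_sym; apply/eqP => p00.
  have := pconv 0%N; move: lt; rewrite p00 mul0r mulr0 => lt.
  by rewrite leNgt exprn_gt0.
pose t := p 1%N / p 0%N.
have tM : M < t by rewrite /t ltr_pdivlMr.
have t0 : 0 < t by exact: lt_trans tM.
have step n : 0 < p n /\ t * p n <= p n.+1.
  elim: n => [|n [pn tpn]]; first by rewrite /t divfK ?gt_eqF.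
  have pn1 : 0 < p n.+1 by apply: lt_le_trans tpn; exact: mulr_gt0.
  split=> //; rewrite -(ler_pM2l pn); apply: le_trans (pconv n).
  by rewrite expr2 mulrA (mulrC (p n)) ler_wpM2r// ltW.
have geo n : t ^+ n * p 0%N <= p n.
  elim: n => [|n IH]; first by rewrite mul1r.
  apply: le_trans (step n).2; rewrite exprS -mulrA.
  by apply: ler_wpM2l => //; exact: ltW.
have C0 : 0 < C by apply: lt_le_trans p0 _; rewrite -[C]mulr1; exact: pbd 0%N.
(* Some [N] has [(M / t) ^+ N < p 0 / C], against [t ^+ N * p 0 <= p N <= C * M ^+ N]. *)
have : (fun n => (M / t) ^+ n) @ \oo --> (0 : R).
  apply: cvg_expr; rewrite ger0_norm; last by rewrite divr_ge0 ?ltW.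
  by rewrite ltr_pdivrMr// mul1r.
move=> /cvgrPdist_lt/(_ (p 0%N / C)); rewrite divr_gt0// => /(_ isT)[N _].
move=> /(_ N (leqnn N)) /=.
rewrite sub0r normrN => /ltr_normlW; rewrite ltr_pdivlMr// expr_div_n mulrAC.
rewrite ltr_pdivrMr ?exprn_gt0// ltNge (mulrC (p 0%N)) (mulrC _ C).
by rewrite (le_trans (geo N) (pbd N)).
Qed.

(** Here [f], [g], [h] stand for [|a+b|], [|a-b|] and the root of [|a|^2 + b^2]; the bound [K] makes
    the suprema finite. *)
Lemma sup_parallelogram (R : realType) (X : Type) (D : set X) (f g h : X -> R) (K : R) :
  (forall x, D x -> [/\ 0 <= f x, 0 <= g x, 0 <= h x, h x ^+ 2 <= K &
                        f x ^+ 2 + g x ^+ 2 = 2 * h x ^+ 2]) ->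
  2^-1 * (sup [set f x | x in D] ^+ 2 + inf [set g x | x in D] ^+ 2)
    <= sup [set h x | x in D] ^+ 2 /\
  sup [set h x | x in D] ^+ 2
    <= 2^-1 * (sup [set f x | x in D] ^+ 2 + sup [set g x | x in D] ^+ 2).
Proof.
move=> hD; have [->|/set0P[x0 Dx0]] := eqVneq D set0.
  (* On an empty sphere every [sup] and [inf] is 0, so both inequalities read [0 <= 0]. *)
  by rewrite !image_set0 sup0 inf0; split; lra.
have bnd (k : X -> R) : (forall x, D x -> k x ^+ 2 <= 2 * K) -> has_sup [set k x | x in D].
  move=> hk; split; first by exists (k x0), x0.
  by exists (2 * K + 1) => _ [x Dx <-]; have := hk _ Dx; nra.
have sf : has_sup [set f x | x in D].
  by apply: bnd => x /hD[_ _ _ ? ?]; have := sqr_ge0 (g x); lra.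
have sg : has_sup [set g x | x in D].
  by apply: bnd => x /hD[_ _ _ ? ?]; have := sqr_ge0 (f x); lra.
have sh : has_sup [set h x | x in D].
  by apply: bnd => x /hD[_ _ _ ? ?]; have := sqr_ge0 (h x); lra.
have lef x : D x -> f x <= sup [set f x | x in D].
  by move=> Dx; apply: (ub_le_sup sf.2); exists x.
have leg x : D x -> g x <= sup [set g x | x in D].
  by move=> Dx; apply: (ub_le_sup sg.2); exists x.
have leh x : D x -> h x <= sup [set h x | x in D].
  by move=> Dx; apply: (ub_le_sup sh.2); exists x.
have infg : has_lbound [set g x | x in D] by exists 0 => _ [x /hD[? ? ? ?] ? <-].
have geg x : D x -> inf [set g x | x in D] <= g x.
  by move=> Dx; apply: (ge_inf infg); exists x.
have ig0 : 0 <= inf [set g x | x in D].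
  by apply: lb_le_inf => [|_ [x /hD[? ? ? ?] ? <-]//]; exists (g x0), x0.
move: lef leg leh geg ig0.
set F := sup _; set G := sup _; set L := sup _; set I := inf _ => lef leg leh geg ig0.
have [f0 g0 h0 _ _] := hD _ Dx0.
have F0 := le_trans f0 (lef _ Dx0); have G0 := le_trans g0 (leg _ Dx0).
have L0 := le_trans h0 (leh _ Dx0).
have sqle (u v : R) : 0 <= u -> u <= v -> u ^+ 2 <= v ^+ 2.
  by move=> u0 uv; rewrite ler_pXn2r// nnegrE// (le_trans u0).
split.
  (* Pointwise, [f ^+ 2 = 2 * h ^+ 2 - g ^+ 2] is at most [2 * L ^+ 2 - I ^+ 2]. The point [x0]
     shows later that this radicand is nonnegative. *)
  have : F <= Num.sqrt (2 * L ^+ 2 - I ^+ 2).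
    apply: ge_sup; first exact: sf.1.
    move=> _ [x Dx <-]; have [fx gx hx _ e] := hD _ Dx.
    have h1 := sqle _ _ hx (leh _ Dx); have h2 := sqle _ _ ig0 (geg _ Dx).
    by rewrite -[f x]ger0_norm// -sqrtr_sqr ler_wsqrtr//; lra.
  move=> /(sqle _ _ F0); rewrite sqr_sqrtr; first by lra.
  have [fx gx hx _ e] := hD _ Dx0.
  have h1 := sqle _ _ hx (leh _ Dx0); have h2 := sqle _ _ ig0 (geg _ Dx0).
  by have := sqr_ge0 (f x0); lra.
have : L <= Num.sqrt (2^-1 * (F ^+ 2 + G ^+ 2)).
  apply: ge_sup; first exact: sh.1.
  move=> _ [x Dx <-]; have [fx gx hx _ e] := hD _ Dx.
  have h1 := sqle _ _ fx (lef _ Dx); have h2 := sqle _ _ gx (leg _ Dx).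
  by rewrite -[h x]ger0_norm// -sqrtr_sqr ler_wsqrtr//; lra.
move=> /(sqle _ _ L0); rewrite sqr_sqrtr//.
by have := sqr_ge0 F; have := sqr_ge0 G; lra.
Qed.

(** * Semi-inner products *)

(** A common interface for [ip] and the possibly degenerate form [A_ip ip A]. *)
Record semi_inner (R : rcfType) (V : lmodType R[i]) (s : V -> V -> R[i]) : Prop :=
  SemiInner {
    si_linl : forall a x y z, s (a *: x + y) z = a * s x z + s y z;
    si_conj : forall x y, s y x = (s x y)^*%C;
    si_ge0 : forall x, 0 <= s x x }.

Section SemiInnerTheory.
Variables (R : rcfType) (V : lmodType R[i]) (s : V -> V -> R[i]).
Hypothesis sS : semi_inner s.

Definition rip (x y : V) : R := complex.Re (s x y).
Definition sqn (x : V) : R := rip x x.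

Lemma si0l z : s 0 z = 0.
Proof.
have := si_linl sS 1 0 0 z; rewrite scale1r addr0 mul1r => /eqP.
by rewrite -subr_eq subrr eq_sym => /eqP.
Qed.

Lemma siDl x y z : s (x + y) z = s x z + s y z.
Proof. by rewrite -{1}[x]scale1r (si_linl sS) mul1r. Qed.

Lemma siZl a x z : s (a *: x) z = a * s x z.
Proof. by rewrite -[a *: x]addr0 (si_linl sS) si0l addr0. Qed.

Lemma siNl x z : s (- x) z = - s x z.
Proof. by rewrite -scaleN1r siZl mulN1r. Qed.

Lemma siBl x y z : s (x - y) z = s x z - s y z.
Proof. by rewrite siDl siNl. Qed.

Lemma siDr x y z : s z (x + y) = s z x + s z y.
Proof. by rewrite !(si_conj sS _ z) siDl rmorphD. Qed.

Lemma siZr a x z : s z (a *: x) = a^*%C * s z x.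
Proof. by rewrite !(si_conj sS _ z) siZl rmorphM. Qed.

Lemma siNr x z : s z (- x) = - s z x.
Proof. by rewrite !(si_conj sS _ z) siNl rmorphN. Qed.

Lemma siBr x y z : s z (x - y) = s z x - s z y.
Proof. by rewrite siDr siNr. Qed.

Lemma ripC x y : rip x y = rip y x.
Proof. by rewrite /rip (si_conj sS); case: (s _ _). Qed.

Lemma sqn_ge0 x : 0 <= sqn x.
Proof. by have := si_ge0 sS x; rewrite lecE => /andP[]. Qed.

Lemma si_sqn x : s x x = (sqn x)%:C.
Proof.
have := si_ge0 sS x; rewrite /sqn /rip lecE => /andP[/eqP].
by case: (s x x) => a b /= ->.
Qed.

Lemma ripDl x y z : rip (x + y) z = rip x z + rip y z.
Proof. by rewrite /rip siDl raddfD. Qed.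

Lemma ripBl x y z : rip (x - y) z = rip x z - rip y z.
Proof. by rewrite /rip siBl raddfB. Qed.

Lemma ripZl (t : R) x z : rip (t%:C *: x) z = t * rip x z.
Proof. by rewrite /rip siZl; case: (s _ _) => a b /=; rewrite mul0r subr0. Qed.

Lemma ripDr x y z : rip z (x + y) = rip z x + rip z y.
Proof. by rewrite ripC ripDl !(ripC z). Qed.

Lemma ripBr x y z : rip z (x - y) = rip z x - rip z y.
Proof. by rewrite ripC ripBl !(ripC z). Qed.

Lemma ripZr (t : R) x z : rip z (t%:C *: x) = t * rip z x.
Proof. by rewrite ripC ripZl (ripC z). Qed.

Lemma sqnDZ (t : R) x y :
  sqn (x + t%:C *: y) = sqn x + 2 * t * rip x y + t ^+ 2 * sqn y.
Proof.
by rewrite /sqn ripDl !ripDr !ripZl !ripZr (ripC y x); ring.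
Qed.

Lemma sqnB x y : sqn (x - y) = sqn x - 2 * rip x y + sqn y.
Proof. by rewrite /sqn ripBl !ripBr (ripC y x); ring. Qed.

Lemma sqnBC x y : sqn (x - y) = sqn (y - x).
Proof. by rewrite !sqnB (ripC x y); ring. Qed.

Lemma im_si x y : complex.Im (s x y) = rip (- 'i *: x) y.
Proof. by rewrite /rip siZl; case: (s _ _) => a b /=; ring. Qed.

Lemma sqn_i x : sqn (- 'i *: x) = sqn x.
Proof.
by rewrite /sqn /rip siZl siZr; case: (s _ _) => a b /=; ring.
Qed.

Lemma rip_CS x y : rip x y ^+ 2 <= sqn x * sqn y.
Proof.
apply: quadratic_ge0; first exact: sqn_ge0.
by move=> t; rewrite -sqnDZ; exact: sqn_ge0.
Qed.

(** The real Cauchy-Schwarz inequality at [x] and at [- 'i *: x] bounds the real and imaginary parts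
    separately. The factor 2 is harmless where only finiteness is at stake. *)
Lemma normc_si_le x y : Normc.normc (s x y) ^+ 2 <= 2 * (sqn x * sqn y).
Proof.
have h1 := rip_CS x y; have := rip_CS (- 'i *: x) y.
rewrite -im_si sqn_i; move: h1; rewrite /rip; case: (s x y) => a b /= h1 h2.
by rewrite sqr_sqrtr ?addr_ge0 ?sqr_ge0//; lra.
Qed.

End SemiInnerTheory.

(** * Topology of the Hilbert space through the real squared norm [q] *)

Section Hilbert.
Variables (R : realType) (H : completeNormedModType R[i]).
Variable ip : {dot H for @Num.conj R[i]}.
Hypothesis ip_norm : norm_induced_by ip.

Lemma semi_inner_ip : semi_inner ip.
Proof.
split=> [a x y z|x y|x]; last exact: dnorm_ge0.
  by rewrite linearDl /= linearZl_LR.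
by rewrite hermC expr0 mul1r.
Qed.

Let sI := semi_inner_ip.
Local Notation q := (sqn ip).
Local Notation r := (rip ip).

Lemma ltr_norm_sqn (x : H) (e : R) : 0 < e -> (`|x| < e%:C) = (q x < e ^+ 2).
Proof.
move=> e0; have e0' : 0 <= e%:C by rewrite lecR ltW.
rewrite -(@ltr_pXn2r _ 2%N _ `|x|)// ?nnegrE//.
by rewrite ip_norm (si_sqn sI) -rmorphXn ltcR.
Qed.

Lemma sqn_eq0 (x : H) : q x = 0 -> x = 0.
Proof. by move=> h; apply/eqP; rewrite -(dnorm_eq0 ip) (si_sqn sI) h. Qed.

Lemma complex_gt0 (e : R[i]) : 0 < e -> exists2 d : R, 0 < d & e = d%:C.
Proof. by case: e => a b; rewrite ltcE /= => /andP[/eqP -> ?]; exists a. Qed.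

Lemma ball_sqn (x y : H) (e : R) : 0 < e -> ball x e%:C y = (q (x - y) < e ^+ 2) :> Prop.
Proof. by move=> e0; rewrite -ball_normE /= ltr_norm_sqn. Qed.

Lemma closure_sqn (W : set H) v :
  closure W v <-> forall e : R, 0 < e -> exists2 w, W w & q (v - w) < e.
Proof.
split=> [cl e e0|h B /nbhs_ballP[e /= /complex_gt0[d d0 ->]] sub].
  have s0 : 0 < Num.sqrt e by rewrite sqrtr_gt0.
  have [|w []] := cl (ball v (Num.sqrt e)%:C).
    by apply: nbhsx_ballx; rewrite ltcR.
  by rewrite ball_sqn// sqr_sqrtr ?ltW//; exists w.
have [|w Ww qw] := h (d ^+ 2); first exact: exprn_gt0.
by exists w; split => //; apply: sub; rewrite ball_sqn.
Qed.

(** Completeness of [H], restated with real radii because the norm of [H] takes its values in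
    [R[i]]. *)
Lemma sqn_cauchy_cvg (u : nat -> H) (c : nat -> R) :
  (c @ \oo --> (0 : R)) ->
  (forall n k, q (u n - u k) <= c n + c k) ->
  exists v, forall e : R, 0 < e -> \forall n \near \oo, q (v - u n) < e.
Proof.
move=> c0 uc.
have clt (e : R) : 0 < e -> \forall n \near \oo, c n < e.
  move=> e0; have /cvgrPdist_lt/(_ _ e0) := c0.
  by apply: filterS => n; rewrite sub0r normrN => /ltr_normlW.
have : cauchy (u @ \oo).
  apply/cauchy_exP => e /complex_gt0[d d0 ->].
  have d2 : 0 < d ^+ 2 / 2 by rewrite divr_gt0 ?exprn_gt0.
  have [N _ hN] := clt _ d2.
  exists (u N); exists N => // n /= Nn.
  rewrite ball_sqn//; apply: (le_lt_trans (uc _ _)).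
  have := hN N (leqnn _); have := hN n Nn; rewrite /=; lra.
move=> /cauchy_cvgP uv; exists (lim (u @ \oo)) => e e0.
have s0 : 0 < Num.sqrt e by rewrite sqrtr_gt0.
have /cvg_ballP/(_ (Num.sqrt e)%:C) := uv.
rewrite ltcR => /(_ s0); apply: filterS => n.
by rewrite ball_sqn// sqr_sqrtr ?ltW.
Qed.

(** * Subspaces and the Riesz theorem *)

Definition subspace (W : set H) :=
  W 0 /\ forall (a : R[i]) x y, W x -> W y -> W (a *: x + y).

Section Subspace.
Variable W : set H.
Hypothesis W_sub : subspace W.

Lemma subspaceZ a x : W x -> W (a *: x).
Proof. by move=> Wx; rewrite -[_ *: _]addr0; apply: (W_sub.2) => //; exact: W_sub.1. Qed.

Lemma subspaceD x y : W x -> W y -> W (x + y).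
Proof. by move=> Wx Wy; rewrite -[x]scale1r; exact: W_sub.2. Qed.

Lemma subspace_closure : subspace (closure W).
Proof.
split; first by apply: subset_closure; exact: W_sub.1.
move=> a x y /closure_sqn cx /closure_sqn cy; apply/closure_sqn => e e0.
(* The [+ 1] allows division by [K] even when [a = 0]. *)
pose K := Normc.normc a ^+ 2 + 1.
have K0 : 0 < K by rewrite ltr_wpDl ?sqr_ge0.
have [|x' Wx' hx] := cx (e / (4 * K)); first by rewrite divr_gt0// mulr_gt0.
have [|y' Wy' hy] := cy (e / 4); first by rewrite divr_gt0.
exists (a *: x' + y'); first exact: W_sub.2.
have -> : a *: x + y - (a *: x' + y') = a *: (x - x') - (y' - y).
  by rewrite scalerBr !opprD opprK addrACA [in RHS]addrA [in RHS]addrAC -!addrA.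
have par u v : q (u - v) <= 2 * q u + 2 * q v.
  have := sqn_ge0 sI (u + 1%:C *: v); rewrite (sqnDZ sI) (sqnB sI); lra.
have qZ u : q (a *: u) = Normc.normc a ^+ 2 * q u.
  rewrite /sqn /rip (siZl sI) (siZr sI) (si_sqn sI).
  case: (a) => b c /=; rewrite sqr_sqrtr ?addr_ge0 ?sqr_ge0//.
  by rewrite /sqn /rip; ring.
apply: (le_lt_trans (par _ _)); rewrite qZ (sqnBC sI y').
have : K * q (x - x') < e / 4.
  by rewrite -ltr_pdivlMl// [ltRHS]mulrC -mulrA -invfM.
have := sqn_ge0 sI (x - x'); rewrite /K mulrDl; lra.
Qed.

(** For [w] in [W] close to [v], [q v] is the real part of [<v - w, v>], which Cauchy-Schwarz makes
    small. *)
Lemma closure_ortho_eq0 v :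
  closure W v -> (forall w, W w -> ip w v = 0) -> v = 0.
Proof.
move=> /closure_sqn cv h; apply: sqn_eq0; apply: (@eq0_le_sqr _ _ (q v)) => e e0.
have [w Ww qw] := cv _ e0.
have qv : q v = r (v - w) v by rewrite (ripBl sI) [r w v]/rip h// subr0.
rewrite {1}qv; apply: (le_trans (rip_CS sI _ _)).
by apply: ler_wpM2r; [exact: sqn_ge0|exact: ltW].
Qed.

(* [v] is the limit of a minimizing sequence of [q x - 2 Re f x] on [W]: it is
   Cauchy by the parallelogram law, and the gradient tends to 0 along it. *)
Lemma riesz_closure (f : H -> R[i]) (M : R) :
  0 <= M ->
  (forall a x y, f (a *: x + y) = a * f x + f y) ->
  (forall x, complex.Re (f x) ^+ 2 <= M * q x) ->
  exists2 v, closure W v & forall y, W y -> ip y v = f y.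
Proof.
move=> M0 flin fbd.
have f0 : f 0 = 0.
  have := flin 1 0 0; rewrite scale1r addr0 mul1r => /eqP.
  by rewrite -subr_eq subrr eq_sym => /eqP.
pose g x : R := complex.Re (f x).
have gDZ x (t : R) y : g (x + t%:C *: y) = g x + t * g y.
  by rewrite /g addrC flin; case: (f x) => ? ?; case: (f y) => ? ? /=; ring.
have gB x y : g (x - y) = g x - g y.
  have -> : - y = (-1)%:C *: y by rewrite rmorphN1 scaleN1r.
  by rewrite gDZ mulN1r.
pose J x : R := q x - 2 * g x.
(* By the arithmetic-geometric mean inequality, [2 * g x <= M + q x]. *)
have Jlb x : - M <= J x.
  have := fbd x; rewrite -/(g x) /J; have := sqn_ge0 sI x.
  move: (q x) (g x) => c d c0 hd; rewrite leNgt; apply/negP => lt.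
  have : 0 < (2 * d - (c + M)) * (2 * d + (c + M)) by rewrite mulr_gt0//; lra.
  have := sqr_ge0 (c - M); nra.
have JDZ x (t : R) y : J (x + t%:C *: y) = J x + 2 * t * (r x y - g y) + t ^+ 2 * q y.
  by rewrite /J (sqnDZ sI) gDZ; ring.
pose E := [set J x | x in W].
have infE : has_inf E.
  split; first by exists (J 0), 0 => //; exact: W_sub.1.
  by exists (- M) => _ [x _ <-].
pose m := inf E.
have mJ x : W x -> m <= J x.
  by move=> Wx; apply: ge_inf; [exact: infE.2|exists x].
have [c c_gt0 c_cvg] : exists2 c : nat -> R, (forall n, 0 < c n) & c @ \oo --> (0 : R).
  by exists (fun n => n.+1%:R^-1) => [n|]; [rewrite invr_gt0|exact: cvg_harmonic].
have /choice[u hu] : forall n : nat, exists x, W x /\ J x < m + c n.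
  move=> n; have [_ [x Wx <-] lx] := @inf_adherent _ E (c n) (c_gt0 n) infE.
  by exists x.
(* Since [J (u n + t y) >= m > J (u n) - c n] for every real [t], a quadratic in [t] is nonnegative;
   its discriminant gives the bound. *)
have grad n y : W y -> (r (u n) y - g y) ^+ 2 <= c n * q y.
  move=> Wy; have [Wu Ju] := hu n; apply: quadratic_ge0 => [|t].
    exact: sqn_ge0.
  have := mJ (u n + t%:C *: y); rewrite JDZ => /(_ _) h.
  have /h : W (u n + t%:C *: y) by apply: subspaceD => //; exact: subspaceZ.
  lra.
(* [J] at the midpoint of [u n] and [u k] is the mean of its values there minus [q (u n - u k) / 4],
   and is still at least [m]. *)
have cau n k : q (u n - u k) <= 2 * c n + 2 * c k.
  have [Wn Jn] := hu n; have [Wk Jk] := hu k.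
  have /mJ : W (u n + (2^-1)%:C *: (u k - u n)).
    apply: subspaceD => //; apply: subspaceZ; apply: subspaceD => //.
    by rewrite -scaleN1r; exact: subspaceZ.
  rewrite JDZ (ripBr sI) gB (sqnB sI (u k)) (sqnB sI (u n)) (ripC sI (u k)).
  by move: Jn Jk; rewrite /J -/(q (u n)); lra.
have c2_cvg : (fun n => 2 * c n) @ \oo --> (0 : R).
  by rewrite -[0](mulr0 2); apply: cvgMr; exact: c_cvg.
have [v hv] := sqn_cauchy_cvg c2_cvg cau.
have approx e : 0 < e -> exists n, c n < e /\ q (v - u n) < e.
  move=> e0; have := hv _ e0.
  have /cvgrPdist_lt/(_ _ e0) := c_cvg => h1 h2.
  have [N _ hN] := filterI h1 h2.
  have [/= h3 h4] := hN N (leqnn _); exists N; split => //.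
  by move: h3; rewrite sub0r normrN => /ltr_normlW.
exists v => [|y Wy].
  apply/closure_sqn => e /approx[n [_ qn]].
  by exists (u n) => //; exact: (hu n).1.
have re y' : W y' -> r v y' = g y'.
  move=> Wy'; apply/eqP; rewrite -subr_eq0; apply/eqP.
  apply: (@eq0_le_sqr _ _ (4 * q y')) => e /approx[n [en qn]].
  have h1 := grad n _ Wy'; have h2 := rip_CS sI (v - u n) y'.
  move: h2; rewrite (ripBl sI) => h2.
  have := sqn_ge0 sI y'.
  set a := r v y' in h2 *; set b := r (u n) y' in h1 h2; set d := g y' in h1 *.
  move=> q0.
  have : (a - d) ^+ 2 <= 2 * (b - d) ^+ 2 + 2 * (a - b) ^+ 2.
    by have := sqr_ge0 (a - b - (b - d)); lra.
  move=> /le_trans; apply.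
  have : c n * q y' <= e * q y' by apply: ler_wpM2r => //; exact: ltW.
  have : q (v - u n) * q y' <= e * q y' by apply: ler_wpM2r => //; exact: ltW.
  lra.
(* The real-part identity at [- 'i *: y] supplies the imaginary part at [y]. *)
have := re _ Wy; have := re _ (subspaceZ (- 'i) Wy).
rewrite (ripC sI) -(im_si sI) (ripC sI v).
rewrite /g -[_ *: y]addr0 flin f0 addr0 /rip.
case: (ip y v) => a b; case: (f y) => a' b' /=; rewrite oppr0 mul0r sub0r mulN1r opprK.
by move=> -> ->.
Qed.
End Subspace.

(** * Bounded operators and Hilbert adjoints *)

Lemma bounded_sqn (T : H -> H) :
  bounded_operators T <->
  (forall a x y, T (a *: x + y) = a *: T x + T y) /\
  exists2 K : R, 0 <= K & forall x, q (T x) <= K * q x.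
Proof.
have nE x : `|x| ^+ 2 = (q x)%:C by rewrite ip_norm (si_sqn sI).
split=> [[Tl [M hM]]|[Tl [K K0 hK]]]; split=> //.
  exists (M ^+ 2) => [|x]; first exact: sqr_ge0.
  have := hM x; rewrite -(@ler_pXn2r _ 2%N)// ?nnegrE//; last first.
    exact: le_trans (hM x).
  by rewrite exprMn !nE -rmorphXn -rmorphM lecR.
exists (Num.sqrt K) => x.
have sK : 0 <= (Num.sqrt K)%:C :> R[i] by rewrite lecR sqrtr_ge0.
rewrite -(@ler_pXn2r _ 2%N)// ?nnegrE ?mulr_ge0//.
by rewrite exprMn !nE -rmorphXn -rmorphM lecR sqr_sqrtr.
Qed.

Lemma subspaceT : subspace [set: H].
Proof. by []. Qed.

Lemma ip_inj x y : (forall z, ip z x = ip z y) -> x = y.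
Proof.
move=> h; apply/eqP; rewrite -subr_eq0; apply/eqP/sqn_eq0.
by rewrite /sqn /rip (siBr sI) h subrr.
Qed.

(** Riesz on the whole space represents [x |-> ip (T x) y]; uniqueness of the representing vector
    gives linearity in [y]. *)
Lemma adjointP (T : H -> H) : bounded_operators T ->
  bounded_operators (adjoint ip T) /\
  forall x y, ip (T x) y = ip x (adjoint ip T y).
Proof.
move=> /bounded_sqn[Tl [K K0 hK]].
suff : exists S, bounded_operators S /\ forall x y, ip (T x) y = ip x (S y).
  exact: xgetPex.
have /choice[S hS] : forall y, exists v, forall x, ip (T x) y = ip x v.
  move=> y.
  have [|a x x'|x|v _ hv] := @riesz_closure _ subspaceT (fun x => ip (T x) y) (K * q y).
  - by rewrite mulr_ge0 ?(sqn_ge0 sI).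
  - by rewrite Tl (siDl sI) (siZl sI).
  - apply: (le_trans (rip_CS sI _ _)); rewrite mulrAC.
    by apply: ler_wpM2r => //; exact: sqn_ge0.
  by exists v => x; rewrite hv.
exists S; split=> //; apply/bounded_sqn; split=> [a x y|].
  by apply: ip_inj => z; rewrite (siDr sI) (siZr sI) -!hS (siDr sI) (siZr sI).
exists K => // y.
(* Cauchy-Schwarz then gives [q (S y) ^+ 2 <= K * q (S y) * q y], and a nonzero [q (S y)]
   cancels. *)
have qS : q (S y) = r (T (S y)) y by rewrite /sqn /rip hS.
have := rip_CS sI (T (S y)) y; rewrite -qS => h.
have [->|S0] := eqVneq (q (S y)) 0; first by rewrite mulr_ge0 ?(sqn_ge0 sI).
have Spos : 0 < q (S y) by rewrite lt_neqAle eq_sym S0 (sqn_ge0 sI).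
rewrite -(ler_pM2l Spos) -expr2 mulrCA mulrA; apply: (le_trans h).
by apply: ler_wpM2r; [exact: sqn_ge0|exact: hK].
Qed.

(** * The form of a positive operator and the projection onto the closure of its range *)

Section PositiveOperator.
Variable A : H -> H.
Hypothesis A_bounded : bounded_operators A.
Hypothesis A_psd : positive_semidefinite ip A.

Let A_linear a x y : A (a *: x + y) = a *: A x + A y.
Proof. by case/bounded_sqn: A_bounded. Qed.

Lemma A_ip_linl a x y z : A_ip ip A (a *: x + y) z = a * A_ip ip A x z + A_ip ip A y z.
Proof. by rewrite /A_ip A_linear (siDl sI) (siZl sI). Qed.

(* Polarization: [<A z, z>] is real at [z = x + y] and at [z = i x + y]. *)
Lemma A_ip_conj x y : A_ip ip A y x = (A_ip ip A x y)^*%C.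
Proof.
have re z : complex.Im (A_ip ip A z z) = 0.
  by have := A_psd z; rewrite lecE => /andP[/eqP].
have sr a u v w : A_ip ip A w (a *: u + v) = a^*%C * A_ip ip A w u + A_ip ip A w v.
  by rewrite /A_ip (siDr sI) (siZr sI).
have := re (1 *: x + y); have := re ('i *: x + y).
rewrite !A_ip_linl !sr; have := re x; have := re y.
case: (A_ip ip A x x) => a1 a2; case: (A_ip ip A y y) => b1 b2.
case: (A_ip ip A x y) => c1 c2; case: (A_ip ip A y x) => d1 d2 /= -> -> h1 h2.
by congr (_ +i* _)%C; lra.
Qed.

Lemma semi_inner_A_ip : semi_inner (A_ip ip A).
Proof. by split; [exact: A_ip_linl|exact: A_ip_conj|exact: A_psd]. Qed.

Lemma A_selfadjoint x y : ip (A x) y = ip x (A y).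
Proof. by rewrite (si_conj sI (A y) x); exact: A_ip_conj. Qed.

Lemma subspace_range : subspace (range A).
Proof.
have A0 : A 0 = 0.
  by have := A_linear (-1) 0 0; rewrite scaleN1r oppr0 add0r scaleN1r addNr.
split; first by exists 0.
by move=> a _ _ [x _ <-] [y _ <-]; exists (a *: x + y).
Qed.

(** [P x] represents [y |-> ip y x] on the range of [A]. Self-adjointness of [A] turns this into
    [A \o P = A], and uniqueness within the closure makes [P] linear. *)
Lemma range_projection : exists P : H -> H,
  [/\ bounded_operators P, range P `<=` closure (range A) & A \o P = A].
Proof.
have subA := subspace_range; have subcA := subspace_closure subA.
have /choice[P hP] : forall x, exists v, closure (range A) v /\
    forall y, ip (A y) v = ip (A y) x.
  move=> x; have [||y|v cv hv] := @riesz_closure _ subA (fun y => ip y x) (q x).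
  - exact: sqn_ge0.
  - by move=> a y y'; rewrite (siDl sI) (siZl sI).
  - by rewrite mulrC; exact: rip_CS.
  by exists v; split => // y; apply: hv; exists y.
have uniq u v : closure (range A) u -> closure (range A) v ->
    (forall y, ip (A y) u = ip (A y) v) -> u = v.
  move=> cu cv h; apply/eqP; rewrite -subr_eq0; apply/eqP.
  apply: (@closure_ortho_eq0 (range A)).
    by have := subcA.2 (-1) v u cv cu; rewrite scaleN1r addrC.
  by move=> _ [y _ <-]; rewrite (siBr sI) h subrr.
exists P; split.
- apply/bounded_sqn; split=> [a x y|].
    apply: uniq; [exact: (hP (a *: x + y)).1|exact: subcA.2 (hP x).1 (hP y).1|move=> z].
    by rewrite (siDr sI) (siZr sI) (hP (a *: x + y)).2 (hP x).2 (hP y).2 (siDr sI) (siZr sI).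
  exists 1 => // x; rewrite mul1r.
  have := sqn_ge0 sI (x - P x); rewrite (sqnB sI).
  (* This says that [x - P x] is orthogonal to [P x]: orthogonality to the range passes to its
     closure. *)
  suff -> : r x (P x) = q (P x) by lra.
  rewrite (ripC sI); apply/eqP; rewrite -subr_eq0; apply/eqP.
  rewrite /sqn -(ripBr sI).
  apply: (@eq0_le_sqr _ _ (q (x - P x))) => e e0.
  have /closure_sqn/(_ _ e0)[_ [y _ <-] qe] := (hP x).1.
  have o : r (A y) (x - P x) = 0.
    by rewrite /rip (siBr sI) (hP x).2 subrr.
  have -> : r (P x) (x - P x) = r (P x - A y) (x - P x).
    by rewrite (ripBl sI) o subr0.
  apply: (le_trans (rip_CS sI _ _)).
  by apply: ler_wpM2r; [exact: sqn_ge0|exact: ltW].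
- by move=> _ [x _ <-]; exact: (hP x).1.
apply/funext => x /=; apply: ip_inj => z.
by rewrite -!A_selfadjoint (hP x).2.
Qed.

(** * Operators with an A-adjoint *)

Section Adjointable.
Variable T : H -> H.
Hypothesis T_adj : A_adjointable ip A T.

Lemma sharpP : A_adjoints ip A T (sharp ip A T).
Proof.
have [_ [X [/bounded_sqn[Xl [K K0 hK]] AX]]] := T_adj.
have [P [/bounded_sqn[Pl [L L0 hL]] Pr AP]] := range_projection.
suff /(@xgetPex _ (fun=> 0))[] :
  exists Y, A_adjoints ip A T Y /\ range Y `<=` closure (range A) by [].
exists (P \o X); split; last by move=> _ [x _ <-]; apply: Pr; exists (X x).
split; last by rewrite compA AP.
apply/bounded_sqn; split=> [a x y /=|]; first by rewrite Xl Pl.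
exists (L * K) => [|x /=]; first exact: mulr_ge0.
by apply: (le_trans (hL _)); rewrite -mulrA; apply: ler_wpM2l.
Qed.

Let T_bounded : bounded_operators T := T_adj.1.

(** The equation [A T^# = T^* A] applied at [T x], after which [T^*] moves across as [T]. *)
Lemma A_ip_abs2 x y : A_ip ip A (A_abs2 ip A T x) y = A_ip ip A (T x) (T y).
Proof.
have [_ /(congr1 (fun f => f (T x))) /= h] := sharpP.
by rewrite /A_ip /A_abs2 /= h (si_conj sI) -(adjointP T_bounded).2 -(si_conj sI).
Qed.

Local Notation a := (A_ip ip A).
Local Notation S := (A_abs2 ip A T).
Let sA : semi_inner a := semi_inner_A_ip.

Lemma A_ip_abs2C x y : a (S x) y = a x (S y).
Proof. by rewrite (si_conj sA (S y)) !A_ip_abs2 -(si_conj sA). Qed.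

Lemma A_ip_bounded : exists2 K : R, 0 <= K & forall x, sqn a (T x) <= K * sqn a x.
Proof.
have [/bounded_sqn[_ [K1 K10 hK1]] _] := sharpP.
have [_ [K2 K20 hK2]] := (bounded_sqn T).1 T_bounded.
have [_ [L L0 hL]] := (bounded_sqn A).1 A_bounded.
(* [K1 * K2] bounds [S] in squared norm; the [+ 1] makes [M] positive, as [log_convex_le]
   requires. *)
pose M := K1 * K2 + 1.
have M0 : 0 < M by rewrite ltr_wpDl ?mulr_ge0.
have hS n x : q (iter n S x) <= M ^+ n * q x.
  elim: n => [|n IH]; first by rewrite mul1r.
  rewrite iterS; apply: (le_trans (hK1 _)).
  apply: (@le_trans _ _ (M * q (iter n S x))).
    have := hK2 (iter n S x); have := sqn_ge0 sI (iter n S x); rewrite /M; nra.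
  by rewrite exprS -mulrA; apply: ler_wpM2l => //; exact: ltW.
have aq x : sqn a x <= (L + 1) * q x.
  apply: le_succ_mul_of_sqr; rewrite ?(sqn_ge0 sA) ?(sqn_ge0 sI)//.
  apply: (le_trans (rip_CS sI (A x) x)).
  by apply: ler_wpM2r; [exact: sqn_ge0|exact: hL].
have Sbd x : sqn a (S x) <= M * sqn a x.
  apply: (@log_convex_le _ (fun n => sqn a (iter n S x)) ((L + 1) * q x)) => // n.
  - exact: sqn_ge0.
  (* Moving one [S] across the form makes log-convexity an instance of Cauchy-Schwarz. *)
  - have -> : sqn a (iter n.+1 S x) = rip a (iter n S x) (iter n.+2 S x).
      by congr complex.Re; exact: A_ip_abs2C.
    exact: rip_CS.
  - apply: (le_trans (aq _)); rewrite -mulrA (mulrC (q x)).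
    by apply: ler_wpM2l; [exact: addr_ge0|exact: hS].
exists (M + 1) => [|x]; first by rewrite addr_ge0// ltW.
apply: le_succ_mul_of_sqr; rewrite ?(sqn_ge0 sA) ?(ltW M0)//.
have -> : sqn a (T x) = rip a (S x) x by rewrite /rip A_ip_abs2.
apply: (le_trans (rip_CS sA _ _)).
by apply: ler_wpM2r; [exact: sqn_ge0|exact: Sbd].
Qed.
End Adjointable.
End PositiveOperator.
End Hilbert.

Theorem theorem2p10 (R : realType) (H : completeNormedModType (complex R))
    (ip : {dot H for @Num.conj (complex R)})
    (ip_norm : norm_induced_by ip)
    (A : H -> H) (A_bounded : bounded_operators A)
    (A_psd : positive_semidefinite ip A)
    (T : H -> H) (T_adj : A_adjointable ip A T) :
  2^-1 * (w_A ip A (T \+ A_abs2 ip A T) ^+ 2 +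
          c_A ip A (T \- A_abs2 ip A T) ^+ 2)
    <= dw_A ip A T ^+ 2 /\
  dw_A ip A T ^+ 2
    <= 2^-1 * (w_A ip A (T \+ A_abs2 ip A T) ^+ 2 +
               w_A ip A (T \- A_abs2 ip A T) ^+ 2).
Proof.
have sA := semi_inner_A_ip ip_norm A_bounded A_psd.
have [K K0 hK] := A_ip_bounded ip_norm A_bounded A_psd T_adj.
(* On the sphere [|a|^2 <= 2 * K] by [normc_si_le], and [b^2 <= K ^+ 2]. *)
apply: (@sup_parallelogram _ _ _ _ _ _ (2 * K + K ^+ 2)) => x.
rewrite /A_sphere /= => /(congr1 (fun t => t ^+ 2)).
rewrite expr1n sqr_sqrtr; last exact: sqn_ge0 sA x.
rewrite -/(rip _ x x) -/(sqn _ x) => x1.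
have := hK x; rewrite x1 mulr1 => Tx.
have Tx0 := sqn_ge0 sA (T x).
have normc_ge0 (z : complex R) : 0 <= Normc.normc z.
  by case: z => ? ?; exact: sqrtr_ge0.
have N4 : A_norm ip A (T x) ^+ 4 = sqn (A_ip ip A) (T x) ^+ 2.
  by rewrite (exprM _ 2 2) sqr_sqrtr.
have := normc_si_le sA (T x) x; rewrite x1 mulr1 => Tx2.
rewrite N4 sqr_sqrtr ?addr_ge0 ?sqr_ge0//.
split; rewrite ?normc_ge0 ?sqrtr_ge0//; first by nra.
(* [b] is real, so adding or subtracting it changes only the real part of [a], and the parallelogram
   identity is a ring identity. *)
rewrite (siDl sA) (siBl sA) (A_ip_abs2 ip_norm A_bounded A_psd T_adj) (si_sqn sA).
case: (A_ip ip A (T x) x) => u v /=.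
by rewrite !sqr_sqrtr ?addr_ge0 ?sqr_ge0//; ring.
Qed.
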